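(* For all integers $\ell\ge 3$, we have $2\ell\le\tilde r(C_4,P_{\ell+1})\le 4\ell-4$. Moreover, $\tilde r(C_4,P_4)=8$.
   Context: $P_s$ denotes the path on $s$ vertices and $C_s$ the cycle on $s$ vertices. Let $K_{\mathbb{N}}$ be the infinite complete graph on vertex set $\mathbb{N}$. In the $\tilde r(G,H)$-game, two players, Builder and Painter, play on the edge set of $K_{\mathbb{N}}$, with no edges coloured initially. In each round Builder chooses an edge and Painter colours it red or blue. Builder wins as soon as there is a red copy of $G$ or a blue copy of $H$. The on-line Ramsey number $\tilde r(G,H)$ is the minimum number of rounds within which Builder can guarantee to win, assuming both players play optimally (Builder minimising and Painter maximising the number of rounds). *)

(* Defs.v *)
From mathcomp Require Import all_boot.

Set Implicit Arguments.
Unset Strict Implicit.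
Unset Printing Implicit Defensive.

Record sgraph := SGraph {
  vertex :> finType;
  adj : rel vertex;
  adj_sym : symmetric adj;
  adj_irr : irreflexive adj }.

Section PathCycle.
Variable s : nat.

Definition path_adj : rel 'I_s := fun i j => (i.+1 == j) || (j.+1 == i).

Fact path_adj_sym : symmetric path_adj.
Proof. by move=> i j; rewrite /path_adj orbC. Qed.

Fact path_adj_irr : irreflexive path_adj.
Proof. by move=> i; rewrite /path_adj orbb eqn_leq ltnn. Qed.

Definition path_graph := SGraph path_adj_sym path_adj_irr.

(* [ordS] is the cyclic successor of 'I_s.  This is the cycle on s vertices   *)
(* for s >= 3; the test i != j only matters for s = 1, where ordS i = i.      *)
Definition cycle_adj : rel 'I_s :=
  fun i j => (i != j) && ((ordS i == j) || (ordS j == i)).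

Fact cycle_adj_sym : symmetric cycle_adj.
Proof. by move=> i j; rewrite /cycle_adj eq_sym orbC. Qed.

Fact cycle_adj_irr : irreflexive cycle_adj.
Proof. by move=> i; rewrite /cycle_adj eqxx. Qed.

Definition cycle_graph := SGraph cycle_adj_sym cycle_adj_irr.

End PathCycle.

(* The edge {x, y} of the complete graph on nat, with x < y, is encoded as    *)
(* the pair (x, y).                                                           *)
Definition edge := {e : nat * nat | e.1 < e.2}.

Definition color := bool.
Definition red : color := true.
Definition blue : color := false.

(* The rounds played so far, the most recent one first. *)
Definition history := seq (edge * color).

Definition joined (h : history) (c : color) (x y : nat) : bool :=
  has (fun m : edge * color =>
         (m.2 == c) && ((val m.1 == (x, y)) || (val m.1 == (y, x)))) h.

(* Copies are subgraphs, not necessarily induced. *)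
Definition has_copy (G : sgraph) (h : history) (c : color) : Prop :=
  exists2 f : G -> nat,
    injective f & forall u v : G, adj u v -> joined h c (f u) (f v).

Definition builder_won (G H : sgraph) (h : history) : Prop :=
  has_copy G h red \/ has_copy H h blue.

Definition builder_strategy := history -> edge.
Definition painter_strategy := history -> edge -> color.

Definition legal (B : builder_strategy) : Prop :=
  forall h : history, B h \notin [seq m.1 | m <- h].

Fixpoint play (B : builder_strategy) (P : painter_strategy) (n : nat)
    : history :=
  if n is n'.+1 then
    let h := play B P n' in (B h, P h (B h)) :: h
  else [::].

Definition wins_within (G H : sgraph) (B : builder_strategy) (k : nat) : Prop :=
  forall P : painter_strategy,
    exists2 n, n <= k & builder_won G H (play B P n).

Definition builder_can_win_within (G H : sgraph) (k : nat) : Prop :=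
  exists2 B : builder_strategy, legal B & wins_within G H B k.

Definition is_online_ramsey (G H : sgraph) (r : nat) : Prop :=
  builder_can_win_within G H r /\
  forall k, builder_can_win_within G H k -> r <= k.

Lemma is_online_ramsey_unique (G H : sgraph) (r1 r2 : nat) :
  is_online_ramsey G H r1 -> is_online_ramsey G H r2 -> r1 = r2.
Proof.
move=> [win1 min1] [win2 min2]; apply/eqP.
by rewrite eqn_leq min1 // min2.
Qed.

(* Main.v *)
Require Import Defs.
From mathcomp Require Import all_boot zify.
From Stdlib Require Import ClassicalEpsilon.

Set Implicit Arguments.
Unset Strict Implicit.
Unset Printing Implicit Defensive.

(** For the lower bound, Painter paints an edge red unless this completes a red
C4.  There is then never a red C4, so Builder must produce a blue path, and the
ends of every blue edge are the ends of a red path with three edges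
(greedy_invariant).  A blue path on l + 1 vertices therefore has all its
vertices in one red component.  Since l + 1 vertices of one component need l
edges (rounds_connected), there are at least l red edges besides the l blue
ones.  For l = 3 one more remark is needed: if a b c d is a blue path, then red paths with
three edges between a and b, between b and c, and between c and d cannot be
packed into four red edges without a red C4 (five_red_edges); hence at least
3 + 5 rounds.

For the upper bound, let u and v be the ends of a blue path and z a new vertex.
If Builder plays uz and vz, then the path gets longer or z becomes a common red
neighbour of u and v; two common red neighbours make a red C4.  So each new
vertex of the path costs at most four rounds (forces_extend), and only two if u
and v have a common red neighbour already (forces_extend_tied).  It remains to
win against P4 in eight rounds (forces_P4).  Builder starts with a triangle.
Two blue edges in it form a blue path on three vertices, and four more rounds
suffice.  With at most one blue edge the red edges of the triangle supply the
common red neighbours that make the remaining five rounds sufficient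
(forces_P4_one_blue, forces_P4_no_blue).

Builder's play is described by the predicate forces, a game tree unfolded from
the current position; forces_win reads a legal strategy off such a tree. *)

(** * Playing edges *)

Arguments joined : simpl never.

Definition edge01 : edge := exist (fun e : nat * nat => e.1 < e.2) (0, 1) isT.

(** The junk value edge01 on the diagonal keeps the map total, so that rewriting
is not hindered by a proof of x != y inside the edge. *)
Definition edge_of (x y : nat) : edge := insubd edge01 (minn x y, maxn x y).

Lemma val_edge_of x y : x != y -> val (edge_of x y) = (minn x y, maxn x y).
Proof. by move=> xy; rewrite val_insubd /=; case: ltnP => //; lia. Qed.

Lemma joined_sym h c x y : joined h c x y = joined h c y x.
Proof. by apply: eq_has => m; rewrite [(_ == (y, x)) || _]orbC. Qed.

Lemma joined_neq h c x y : joined h c x y -> x != y.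
Proof.
case/hasP=> -[[[a b] /= ab] c'] _ /andP[_].
by rewrite !xpair_eqE; lia.
Qed.

Lemma joined_cons h x y c c' u v : x != y ->
  joined ((edge_of x y, c) :: h) c' u v =
  (c == c') && ((x == u) && (y == v) || (x == v) && (y == u)) || joined h c' u v.
Proof.
move=> xy; rewrite /joined /= val_edge_of // !xpair_eqE; congr (_ && _ || _).
by lia.
Qed.

Lemma joined_catr h' h c x y : joined h c x y -> joined (h' ++ h) c x y.
Proof. by rewrite /joined has_cat orbC => ->. Qed.

Definition unplayed (h : history) x y := forall c, ~~ joined h c x y.

Lemma unplayed_edge_of h x y : x != y -> unplayed h x y ->
  edge_of x y \notin [seq m.1 | m <- h].
Proof.
move=> xy unp; apply/mapP=> -[[e c] he /= ex]; case/negP: (unp c).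
apply/hasP; exists (e, c) => //=.
by rewrite -ex eqxx val_edge_of // !xpair_eqE /=; lia.
Qed.

Definition isolated (h : history) z := forall y, unplayed h z y.

(** Only finitely many vertices have been touched; the list s lets the new
vertex avoid further ones. *)
Lemma exists_isolated h (s : seq nat) : exists2 z, z \notin s & isolated h z.
Proof.
pose t := s ++ [seq (val m.1).2 | m <- h].
have le_max x : x \in t -> x < (\max_(y <- t) y).+1.
  by move=> xt; rewrite ltnS (@leq_bigmax_seq _ t xpredT id).
exists (\max_(y <- t) y).+1.
  apply: (contraFN _ (ltnn (\max_(y <- t) y).+1)) => zs.
  by rewrite le_max ?mem_cat ?zs.
set z := _.+1 => y c; apply/hasPn=> m hm; apply/negP=> /andP[_ /orP mE].
have /le_max: (val m.1).2 \in t.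
  by rewrite mem_cat (map_f (fun m : edge * color => (val m.1).2)) ?orbT.
by case: m {hm} mE => -[[a b] ab] d /= [] /eqP[ea eb]; move: ab => /=; lia.
Qed.

Lemma isolated_joined h z c x y : isolated h z -> joined h c x y -> z != x.
Proof. by move=> iso; apply: contraTneq => <-; apply: iso. Qed.

(** * Red four-cycles and blue paths *)

Lemma has_red_C4 h a b c d : uniq [:: a; b; c; d] ->
  joined h red a b -> joined h red b c -> joined h red c d ->
  joined h red d a -> has_copy (cycle_graph 4) h red.
Proof.
move=> U ab bc cd da; pose s := [:: a; b; c; d].
exists (fun i : 'I_4 => nth 0 s i).
  by move=> i j /eqP; rewrite nth_uniq // => /eqP/val_inj.
move=> [[|[|[|[|//]]]] ilt] [[|[|[|[|//]]]] jlt] //= _; rewrite ?ab ?bc ?cd ?da //;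
  by rewrite joined_sym ?ab ?bc ?cd ?da.
Qed.

Lemma red_C4P h : has_copy (cycle_graph 4) h red ->
  exists a b c d, [/\ uniq [:: a; b; c; d], joined h red a b, joined h red b c,
    joined h red c d & joined h red d a].
Proof.
case=> f f_inj fE; pose o i : 'I_4 := inord i.
exists (f (o 0)), (f (o 1)), (f (o 2)), (f (o 3)); split;
  last 4 first; try by apply: fE; rewrite /= /cycle_adj -!val_eqE /= !inordK.
by rewrite -[X in uniq X]/(map f [:: o 0; o 1; o 2; o 3]) map_inj_uniq //=
  !inE -!val_eqE /= !inordK.
Qed.

Definition blue_path h s := uniq s && sorted (joined h blue) s.

Lemma has_blue_path h s : blue_path h s ->
  has_copy (path_graph (size s)) h blue.
Proof.
case/andP=> U /(sortedP 0) S; exists (fun i : 'I_(size s) => nth 0 s i).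
  by move=> i j /eqP; rewrite nth_uniq // => /eqP/val_inj.
move=> i j /= /orP[] /eqP e; first by rewrite -e S // e.
by rewrite joined_sym -e S // e.
Qed.

(** * Game trees for Builder *)

(** Edges are required to be unplayed only along the tree, and the goal Q is an
arbitrary property of the position, so that partial plans can be chained
(forces_trans). *)
Fixpoint forces (Q : history -> Prop) k h : Prop :=
  Q h \/ if k is k'.+1 then
    exists2 e : edge, e \notin [seq m.1 | m <- h] &
      forall c, forces Q k' ((e, c) :: h)
  else False.

Lemma forces0 Q k h : Q h -> forces Q k h.
Proof. by case: k; left. Qed.

Lemma forces_leq Q k m h : k <= m -> forces Q k h -> forces Q m h.
Proof.
elim: k m h => [|k IH] [|m] h //= km; first by case=> // Qh; left.
by case=> [|[e eh fe]]; [left | right; exists e => // c; apply: IH].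
Qed.

Lemma forces_trans Q Q' k m h : forces Q k h ->
  (forall h', Q h' -> forces Q' m h') -> forces Q' (k + m) h.
Proof.
move=> + QQ'; elim: k h => [|k IH] h /=; first by case=> [/QQ'|].
case=> [/QQ' F|[e eh fe]]; first exact: (forces_leq (leq_addl k.+1 m) F).
by right; exists e => // c; apply: IH.
Qed.

Lemma forces_play Q k h x y : x != y -> unplayed h x y ->
  forces Q k ((edge_of x y, red) :: h) ->
  forces Q k ((edge_of x y, blue) :: h) -> forces Q k.+1 h.
Proof.
move=> xy unp fr fb; right; exists (edge_of x y).
  exact: unplayed_edge_of.
by case.
Qed.

(** A position determines the number of rounds played, hence also the number of
rounds left in the tree, so choosing a good edge in each position defines a
strategy.  In positions outside the tree a new edge keeps the strategy legal. *)
Lemma forces_win G H k : forces (builder_won G H) k [::] ->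
  builder_can_win_within G H k.
Proof.
set Q := builder_won G H => fk.
pose good h e := e \notin [seq m.1 | m <- h] /\
  (forces Q (k - size h) h ->
     Q h \/ forall c, forces Q (k - size h).-1 ((e, c) :: h)).
have step h : exists e, good h e.
  have [z _ isoz] := exists_isolated h [::].
  have fresh : edge_of z z.+1 \notin [seq m.1 | m <- h].
    by apply: unplayed_edge_of; [lia | apply: isoz].
  have [F|nF] := excluded_middle_informative (forces Q (k - size h) h);
    last by exists (edge_of z z.+1).
  have [Qh|nQ] := excluded_middle_informative (Q h).
    by exists (edge_of z z.+1); split=> // _; left.
  rewrite /good; case: (k - size h) F => [|j] /= [] // [e eh fe].
  by exists e; split=> // _; right.
have [B BP] : exists B, forall h, good h (B h).
  exists (fun h => sval (constructive_indefinite_description _ (step h))).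
  by move=> h; apply: svalP.
exists B => [h|P]; first by have [] := BP h.
have szp n : size (play B P n) = n by elim: n => //= n ->.
suff inv n : n <= k -> (exists2 m, m <= n & Q (play B P m)) \/
    forces Q (k - n) (play B P n).
  have [//|] := inv k (leqnn k); rewrite subnn /= => -[Qk|//].
  by exists k.
elim: n => [|n IH] ltnk; first by right; rewrite subn0.
have [[m lemn Qm]|F] := IH (ltnW ltnk).
  by left; exists m; rewrite // ltnW.
have [_ +] := BP (play B P n); rewrite szp => /(_ F)[Qn|].
  by left; exists n.
by move=> /(_ (P (play B P n) (B (play B P n)))); rewrite -subnS; right.
Qed.

(** * Builder's strategy *)

Definition won_path l h := has_copy (cycle_graph 4) h red \/
  exists2 s, size s = l.+1 & blue_path h s.

Lemma won_pathW l h : won_path l h ->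
  builder_won (cycle_graph 4) (path_graph l.+1) h.
Proof. by case=> [|[s <- /has_blue_path]]; [left|right]. Qed.

Lemma blue_path_catr h' h s : blue_path h s -> blue_path (h' ++ h) s.
Proof.
case/andP=> U S; rewrite /blue_path U /=; apply: sub_sorted S => x y.
exact: joined_catr.
Qed.

Lemma blue_path_cons h z u s : z \notin u :: s -> joined h blue u z ->
  blue_path h (u :: s) -> blue_path h [:: z, u & s].
Proof. by rewrite joined_sym /blue_path /= => -> -> /andP[-> ->]. Qed.

Lemma blue_path_rcons h z u s : z \notin u :: s -> joined h blue (last u s) z ->
  blue_path h (u :: s) -> blue_path h (u :: rcons s z).
Proof.
rewrite /blue_path -rcons_cons rcons_uniq /= rcons_path => -> ->.
by case/andP=> -> ->.
Qed.

Lemma blue_path_ends h u s : 0 < size s -> blue_path h (u :: s) ->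
  u != last u s.
Proof.
case: s => // y s _ /andP[/andP[us _] _].
by apply: contraNneq us => e; rewrite e; apply: mem_last.
Qed.

(** Builder joins both ends of a blue path to a new vertex z: a blue answer
extends the path at that end.  The goal Q is left open because the surviving
case, z a common red neighbour of the ends, is used once to finish the game and
once to prepare the next attempt. *)
Lemma forces_probe Q k l h z u s :
  size s = l -> 0 < l -> blue_path h (u :: s) -> z \notin u :: s ->
  isolated h z ->
  (forall h', won_path l.+1 h' -> Q h') ->
  (forall h', joined (h' ++ h) red u z -> joined (h' ++ h) red (last u s) z ->
     forces Q k (h' ++ h)) ->
  forces Q k.+2 h.
Proof.
move=> sz l0 bp zs iso QW F.
have uv : u != last u s by apply: blue_path_ends bp; rewrite sz.
have zu : u != z by apply: contraNneq zs => ->; rewrite mem_head.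
have zv : last u s != z by apply: contraNneq zs => <-; rewrite mem_last.
apply: (@forces_play _ _ _ u z) => //; first by move=> c; rewrite joined_sym iso.
  set h1 := _ :: h; apply: (@forces_play _ _ _ (last u s) z) => //.
  - move=> c; rewrite joined_cons // negb_or joined_sym iso andbT eqxx.
    by rewrite (negPf uv) (negPf zu) /= andbF.
  - by apply: (F [:: _; _]); rewrite !joined_cons // ?eqxx // orbT.
  apply/forces0/QW; right; exists (u :: rcons s z).
    by rewrite /= size_rcons sz.
  apply: blue_path_rcons => //; first by rewrite joined_cons // !eqxx.
  exact: (@blue_path_catr [:: _; _]).
apply/forces0/QW; right; exists [:: z, u & s]; first by rewrite /= sz.
apply: blue_path_cons => //; first by rewrite joined_cons // !eqxx.
exact: (@blue_path_catr [:: _]).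
Qed.

(** A second common red neighbour z of the ends u and v closes the red cycle
u x v z.  The vertex x may lie on the path. *)
Lemma forces_extend_tied l h x u s :
  size s = l -> 0 < l -> blue_path h (u :: s) ->
  joined h red u x -> joined h red (last u s) x ->
  forces (won_path l.+1) 2 h.
Proof.
move=> sz l0 bp ux vx; have [z zs iso] := exists_isolated h (u :: s).
apply: (forces_probe sz l0 bp zs iso) => // h' uz vz; left; left.
have uv : u != last u s by apply: blue_path_ends bp; rewrite sz.
apply: (@has_red_C4 _ u x (last u s) z).
- rewrite /= !inE.
  have := isolated_joined iso (etrans (joined_sym _ _ _ _) ux).
  move: (joined_neq ux) (joined_neq vx) (joined_neq uz) (joined_neq vz).
  by move: (last u s) uv => v; lia.
- exact: joined_catr.
- by rewrite joined_sym; apply: joined_catr.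
- by [].
by rewrite joined_sym.
Qed.

(** Two new vertices are joined to both ends; a Painter who never extends
the path makes both of them common red neighbours of the ends. *)
Lemma forces_extend l h s : size s = l.+1 -> 0 < l -> blue_path h s ->
  forces (won_path l.+1) 4 h.
Proof.
case: s => // u s [sz] l0 bp; have [z zs iso] := exists_isolated h (u :: s).
apply: (forces_probe sz l0 bp zs iso) => // h' uz vz.
exact: forces_extend_tied sz l0 (blue_path_catr _ bp) uz vz.
Qed.

(** With a new vertex y, play ya and yb.  If ya is blue, y a b is a blue path
and four rounds remain.  If both are red, a x b y is a red C4.  Otherwise a b y
is a blue path, and yx either extends it to a blue P4 or makes x a common red
neighbour of its ends a and y. *)
Lemma forces_P4_one_blue h a b x : joined h blue a b -> joined h red a x ->
  joined h red b x -> forces (won_path 3) 5 h.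
Proof.
move=> ab ax bx; have [y _ iso] := exists_isolated h [::].
have ya := isolated_joined iso ab.
have yb := isolated_joined iso (etrans (joined_sym _ _ _ _) ab).
have yx := isolated_joined iso (etrans (joined_sym _ _ _ _) ax).
move: (joined_neq ab) (joined_neq ax) (joined_neq bx) => nab nax nbx.
apply: (@forces_play _ _ _ y a) => //; last first.
  apply: (@forces_extend 2 _ [:: y; a; b]) => //.
  rewrite /blue_path /= !joined_cons // ab !eqxx !inE /= orbT !andbT; lia.
apply: (@forces_play _ _ _ y b) => //.
- by move=> c; rewrite joined_cons // (negPf (iso _ _)); lia.
- apply/forces0; left; apply: (@has_red_C4 _ a x b y);
    rewrite 1?[joined _ _ x b]joined_sym ?joined_cons // ?eqxx ?ax ?bx ?orbT //=.
  by rewrite !inE; lia.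
apply: (@forces_play _ _ _ y x) => //.
- by move=> c; rewrite !joined_cons // (negPf (iso _ _)); lia.
- apply: (@forces_extend_tied 2 _ x a [:: b; y]) => //=;
    rewrite /blue_path /= ?joined_cons // ?ab ?ax ?eqxx ?orbT //=.
  by rewrite !inE; lia.
apply/forces0; right; exists [:: a; b; y; x] => //.
rewrite /blue_path /= !joined_cons // ab !eqxx !inE /= !orbT; lia.
Qed.

(** Join a new vertex y to the triangle.  Two of the three edges get the same
colour: if red, they close a red C4 around two sides of the triangle; if blue,
they form a blue path whose ends have the third vertex of the triangle as a
common red neighbour. *)
Lemma forces_P4_no_blue h a b c : joined h red a b -> joined h red b c ->
  joined h red c a -> forces (won_path 3) 5 h.
Proof.
move=> ab bc ca; have [y _ iso] := exists_isolated h [::].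
have ya := isolated_joined iso ab; have yb := isolated_joined iso bc.
have yc := isolated_joined iso ca.
move: (joined_neq ab) (joined_neq bc) (joined_neq ca) => nab nbc nca.
have tri h' p q r d : (forall e u v, joined h e u v -> joined h' e u v) ->
  uniq [:: p; q; r; y] ->
  joined h red p q -> joined h red q r -> joined h red r p ->
  joined h' d y p -> joined h' d y r -> forces (won_path 3) 2 h'.
  move=> sub U pq qr rp yp yr; case: d yp yr => yp yr.
    apply/forces0; left; apply: (has_red_C4 U _ _ _ yp); try exact: sub.
    by rewrite joined_sym.
  apply: (@forces_extend_tied 2 _ q p [:: y; r]) => //; first 1 last.
  - exact: sub.
  - by rewrite joined_sym; apply: sub.
  rewrite /blue_path /= (joined_sym _ _ p) yp yr.
  by move: U; rewrite /= !inE; lia.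
have step p q : forall h0, y != p -> (forall d, ~~ joined h0 d y p) ->
  (forall d, forces (won_path 3) q ((edge_of y p, d) :: h0)) ->
  forces (won_path 3) q.+1 h0.
  by move=> h0 yp unp F; apply: (@forces_play _ _ _ y p).
apply: (step _ _ _ ya (iso a)) => d1; apply: (step b) => // [d|d2].
  by rewrite joined_cons // (negPf (iso _ _)); lia.
apply: (step c) => // [d|d3].
  by rewrite !joined_cons // (negPf (iso _ _)); lia.
set h3 := _ :: _ :: _.
have sub e u v : joined h e u v -> joined h3 e u v.
  exact: (@joined_catr [:: _; _; _]).
have ja : joined h3 d1 y a by rewrite !joined_cons // !eqxx /= !orbT.
have jb : joined h3 d2 y b by rewrite !joined_cons // !eqxx /= !orbT.
have jc : joined h3 d3 y c by rewrite !joined_cons // !eqxx.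
have : [|| d1 == d2, d2 == d3 | d3 == d1] by clear; case: d1 d2 d3 => [] [] [].
case/or3P=> /eqP e; [rewrite -e in jb | rewrite -e in jc | rewrite -e in ja].
- by apply: (tri h3 b c a d1) => //; rewrite /= !inE; lia.
- by apply: (tri h3 c a b d2) => //; rewrite /= !inE; lia.
by apply: (tri h3 a b c d3) => //; rewrite /= !inE; lia.
Qed.

(** Builder plays a triangle and continues according to the number of blue edges
in it. *)
Lemma forces_P4 : forces (won_path 3) 8 [::].
Proof.
have step k h x y : x != y -> unplayed h x y ->
    (forall c, forces (won_path 3) k ((edge_of x y, c) :: h)) ->
    forces (won_path 3) k.+1 h.
  by move=> xy unp F; apply: (@forces_play _ _ _ x y).
apply: (step _ _ 0 1) => // c1.
apply: (step _ _ 1 2) => // [c|c2]; first by rewrite joined_cons // andbF.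
apply: (step _ _ 2 0) => // [c|c3]; first by rewrite !joined_cons // !andbF.
set h := _ :: _ :: _.
have j1 : joined h c1 0 1 by rewrite !joined_cons // !eqxx !orbT.
have j2 : joined h c2 1 2 by rewrite !joined_cons // !eqxx !orbT.
have j3 : joined h c3 2 0 by rewrite !joined_cons // !eqxx.
have two_blue a b c : uniq [:: a; b; c] -> joined h blue a b ->
    joined h blue b c -> forces (won_path 3) 5 h.
  move=> U ab bc; apply: (@forces_leq _ 4) => //.
  by apply: (@forces_extend 2 _ [:: a; b; c]); rewrite // /blue_path U /= ab bc.
have one_blue a b x : joined h blue a b -> joined h red b x ->
    joined h red x a -> forces (won_path 3) 5 h.
  move=> ab bx xa; apply: (forces_P4_one_blue ab _ bx).
  by rewrite joined_sym.
move: c1 c2 c3 @h j1 j2 j3 two_blue one_blue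
  => [] [] [] h j1 j2 j3 two_blue one_blue.
- exact: forces_P4_no_blue j1 j2 j3.
- exact: one_blue j3 j1 j2.
- exact: one_blue j2 j3 j1.
- exact: two_blue j2 j3.
- exact: one_blue j1 j2 j3.
- exact: two_blue j3 j1.
- exact: two_blue j1 j2.
exact: two_blue j1 j2.
Qed.

Lemma forces_path l : 3 <= l -> forces (won_path l) (4 * l - 4) [::].
Proof.
elim: l => // l IH; rewrite leq_eqVlt => /orP[/eqP [<-]|l3].
  exact: forces_P4.
have -> : 4 * l.+1 - 4 = 4 * l - 4 + 4 by lia.
apply: forces_trans (IH l3) _ => h [C4|[s sz bp]].
  by apply/forces0; left.
by apply: forces_extend sz _ bp; lia.
Qed.

(** * Painter's greedy strategy *)

Definition greedy : painter_strategy := fun h e =>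
  if excluded_middle_informative
       (has_copy (cycle_graph 4) ((e, red) :: h) red)
  then blue else red.

Definition red_path3 h u v := exists x y, [/\ uniq [:: u; x; y; v],
  joined h red u x, joined h red x y & joined h red y v].

Lemma red_path3_sym h u v : red_path3 h u v -> red_path3 h v u.
Proof.
case=> x [y [U ux xy yv]]; exists y, x.
by rewrite -(rev_uniq [:: u; x; y; v]) in U; split; rewrite // joined_sym.
Qed.

Lemma edgeP (e : edge) : exists2 p : nat * nat, p.1 != p.2 & e = edge_of p.1 p.2.
Proof.
exists (val e); first by have := valP e; lia.
apply: val_inj; case: e => -[x y] /= xy.
by rewrite val_edge_of; [congr (_, _)|]; lia.
Qed.

(** The new edge xy must lie on the red C4, as there was none before; the other
three edges of the cycle form the path. *)
Lemma red_path3_of_C4 h x y : x != y ->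
  ~ has_copy (cycle_graph 4) h red ->
  has_copy (cycle_graph 4) ((edge_of x y, red) :: h) red -> red_path3 h x y.
Proof.
move=> xy no4 /red_C4P[a [b [c [d []]]]]; rewrite !joined_cons //=.
suff one p q r s : uniq [:: p; q; r; s] ->
    ((x == p) && (y == q) || (x == q) && (y == p)) -> 
    (((x == q) && (y == r) || (x == r) && (y == q)) || joined h red q r) ->
    (((x == r) && (y == s) || (x == s) && (y == r)) || joined h red r s) ->
    (((x == s) && (y == p) || (x == p) && (y == s)) || joined h red s p) ->
    red_path3 h x y.
  move=> U; have Urot k : uniq (rot k [:: a; b; c; d]) by rewrite rot_uniq.
  move=> /orP[ab|ab] /orP[bc|bc] /orP[cd|cd] /orP[da|da];
    try by [ apply: (one _ _ _ _ (Urot 0)); rewrite ?ab ?bc ?cd ?da ?orbT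
           | apply: (one _ _ _ _ (Urot 1)); rewrite ?ab ?bc ?cd ?da ?orbT
           | apply: (one _ _ _ _ (Urot 2)); rewrite ?ab ?bc ?cd ?da ?orbT
           | apply: (one _ _ _ _ (Urot 3)); rewrite ?ab ?bc ?cd ?da ?orbT ].
  by case: no4; apply: has_red_C4 ab bc cd da.
move=> U e qr rs sp; have {qr rs sp} [qr rs sp] :
    [/\ joined h red q r, joined h red r s & joined h red s p].
  by move: U e qr rs sp; rewrite /= !inE; split; lia.
have P : red_path3 h q p.
  by exists r, s; split => //; move: U; rewrite /= !inE; lia.
by case/orP: e => /andP[/eqP -> /eqP ->] //; apply: red_path3_sym.
Qed.

Lemma red_path3_cons h m u v : red_path3 h u v -> red_path3 (m :: h) u v.
Proof.
case=> x [y [U ux xy yv]].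
by exists x, y; split; rewrite //; apply: (@joined_catr [:: m]).
Qed.

(** The red graph only grows, so a red path that caused an edge to be painted
blue is still there at any later time. *)
Lemma greedy_invariant B n : let h := play B greedy n in
  ~ has_copy (cycle_graph 4) h red /\
  forall u v, joined h blue u v -> red_path3 h u v.
Proof.
elim: n => [|n [no4 bl]] /=.
  split=> // -[f _ /(_ ord0 (inord 1))].
  by rewrite /= /cycle_adj -!val_eqE /= !inordK // => /(_ isT).
set h := play B greedy n in no4 bl *; have [[x y] /= xy ->] := edgeP (B h).
(* A blue edge leaves the red graph as it is, and a red one is accepted only if
   it completes no red C4; so only the second half of the invariant remains. *)
rewrite /greedy; case: excluded_middle_informative => [C4|nC4]; split => //.
  move=> u v; rewrite joined_cons //= => /orP[|/bl/red_path3_cons //].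
  have P := red_path3_cons (edge_of x y, blue) (red_path3_of_C4 xy no4 C4).
  by case/orP=> /andP[/eqP <- /eqP <-] //; apply: red_path3_sym.
by move=> u v; rewrite joined_cons //= => /bl/red_path3_cons.
Qed.

(** * Counting rounds *)

(** Contracting the edges of E one at a time identifies at most one pair of
labels per edge.  The labelling g, whose classes are the components of E, thus
replaces any talk of reachability: vertices in one component are those that
every labelling constant on the edges identifies. *)
Lemma edge_contraction (E : seq (nat * nat)) : exists g : nat -> nat,
  (forall e, e \in E -> g e.1 = g e.2) /\
  forall S, uniq S -> size S <= size (undup (map g S)) + size E.
Proof.
elim: E => [|[u v] E [g [gE gS]]].
  by exists id; split=> // S U; rewrite map_id undup_id // addn0.
exists (fun w => if g w == g u then g v else g w); split=> [e|S US].
  rewrite inE => /predU1P[->/=|/gE ->] //; rewrite eqxx.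
  by case: eqP.
apply: leq_trans (gS S US) _; rewrite /= addnS -addSn leq_add2r.
set g' := fun w => _.
suff : {subset undup (map g S) <= g u :: undup (map g' S)}.
  by move=> /(uniq_leq_size (undup_uniq _)).
move=> w; rewrite mem_undup => /mapP[z zS ->]; rewrite inE mem_undup.
case: (g z =P g u) => //= /eqP zu.
by apply/mapP; exists z; rewrite // /g' (negPf zu).
Qed.

Definition rounds (c : color) (h : history) :=
  count (fun m : edge * color => m.2 == c) h.

Lemma rounds_red_blue h : rounds red h + rounds blue h = size h.
Proof.
rewrite -(count_predC (fun m : edge * color => m.2 == red)); congr (_ + _).
by apply: eq_count => -[e []].
Qed.

(** The hypothesis says, through labellings as in edge_contraction, that S lies
in one component of the graph of colour c. *)
Lemma rounds_connected h c S : uniq S ->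
  (forall g : nat -> nat, (forall u v, joined h c u v -> g u = g v) ->
     forall u v, u \in S -> v \in S -> g u = g v) ->
  size S <= (rounds c h).+1.
Proof.
move=> US conn.
pose E := [seq val m.1 | m : edge * color <- h & m.2 == c].
have [g [gE /(_ S US) le]] := edge_contraction E.
have gj u v : joined h c u v -> g u = g v.
  case/hasP=> -[[p lt_p] d] hp /= /andP[dc pE].
  have /gE : p \in E.
    by apply/mapP; exists (exist _ p lt_p, d); rewrite // mem_filter /= dc.
  by case/orP: pE => /eqP -> /=.
apply: leq_trans le _.
rewrite size_map size_filter -/(rounds c h) -add1n leq_add2r.
have {}conn := conn g gj.
case: S US conn => // x S _ conn.
apply: (@uniq_leq_size _ _ [:: g x] (undup_uniq _)) => w.
rewrite mem_undup => /mapP[z zS ->].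
by rewrite inE; apply/eqP/conn; rewrite ?mem_head.
Qed.

Lemma rounds_distinct h c (s : seq (nat * nat)) :
  all (fun p => joined h c p.1 p.2) s ->
  uniq [seq (minn p.1 p.2, maxn p.1 p.2) | p <- s] -> size s <= rounds c h.
Proof.
move=> J U; rewrite -(size_map (fun p => (minn p.1 p.2, maxn p.1 p.2))).
rewrite /rounds -size_filter -(size_map (fun m : edge * color => val m.1)).
apply: uniq_leq_size U _ => w /mapP[p /(allP J) /hasP[[e d] he /=]].
move=> /andP[dc ee] ->; apply/mapP; exists (e, d).
  by rewrite mem_filter dc.
case: e {he} ee => -[a b] /= ab /orP[]/eqP[<- <-]; congr (_, _); lia.
Qed.

Lemma red_path3_not_red h u v : ~ has_copy (cycle_graph 4) h red ->
  red_path3 h u v -> ~~ joined h red u v.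
Proof.
move=> no4 [x [y [U ux xy yv]]]; apply/negP=> uv; apply: no4.
by apply: has_red_C4 U ux xy yv _; rewrite joined_sym.
Qed.

(** * Five red edges below a blue P4 *)

Lemma unordered_pair_eq (a b x y : nat) :
  ((minn a b, maxn a b) == (minn x y, maxn x y)) =
  (a == x) && (b == y) || (a == y) && (b == x).
Proof. by rewrite xpair_eqE; lia. Qed.

Ltac split_neqs :=
  repeat match goal with
  | H : is_true (uniq _) |- _ => rewrite /= !inE in H
  | H : is_true (_ && _) |- _ => case/andP: H => ? ?
  | H : is_true (~~ (_ || _)) |- _ => rewrite negb_or in H
  | H : is_true (~~ (_ == _)) |- _ => move/eqP: H => H
  end.

Ltac distinct_red_edges s :=
  apply: (@rounds_distinct _ red s);
  [ rewrite /=; repeat (apply/andP; split) => //; by rewrite joined_sym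
  | rewrite /= !inE !unordered_pair_eq !negb_or; split_neqs;
    repeat (apply/andP; split) => //;
    by apply/negP => /andP[/eqP ? /eqP ?]; congruence ].

(** Here the red path b u a c between b and c passes through a.  Let a x y b and
c p q d be the other two paths.  The edge qd is a fourth edge, and the path
c p q d avoids a fifth one only if p = a and q = u.  The four edges then form a
star with centre u and leaves b, a, d, extended by the edge ac.  This is a tree
in which a and b have distance 2, so the path a x y b needs a new edge. *)
Lemma five_red_edges_overlap h a b c d u : uniq [:: a; b; c; d] ->
  uniq [:: b; u; a; c] -> d != u ->
  joined h red b u -> joined h red u a -> joined h red a c ->
  red_path3 h a b -> red_path3 h c d -> 5 <= rounds red h.
Proof.
move=> U Uu du bu ua ac [x [y [Ux ax xy yb]]] [p [q [Up cp pq qd]]].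
have [pa|pa] := eqVneq p a; last first.
  distinct_red_edges [:: (b, u); (u, a); (a, c); (q, d); (c, p)].
subst p; have [qu|qu] := eqVneq q u; last first.
  distinct_red_edges [:: (b, u); (u, a); (a, c); (q, d); (a, q)].
subst q; have [yu|yu] := eqVneq y u; last first.
  distinct_red_edges [:: (b, u); (u, a); (a, c); (u, d); (y, b)].
subst y; have [xd|xd] := eqVneq x d; last first.
  distinct_red_edges [:: (b, u); (u, a); (a, c); (u, d); (x, u)].
subst x; distinct_red_edges [:: (b, u); (u, a); (a, c); (u, d); (a, d)].
Qed.

(** Let a x y b, b u v c and c p q d be the red paths.  As ab and cd are not red
(red_path3_not_red), a is not u and d is not v.  If a and d are not on b u v c,
then ax and qd are new edges; they coincide only if both are ad, and then dy is
new as well.  If exactly one of a and d is on b u v c, the preceding lemma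
applies to a, b, c, d or to the reversed sequence.  If both are, then v = a and
u = d, and the path a x y b needs two edges besides bd, da and ac. *)
Lemma five_red_edges h a b c d : ~ has_copy (cycle_graph 4) h red ->
  uniq [:: a; b; c; d] -> red_path3 h a b -> red_path3 h b c -> red_path3 h c d ->
  5 <= rounds red h.
Proof.
move=> no4 U ab bc cd.
have := red_path3_not_red no4 ab; have := red_path3_not_red no4 cd.
case: (bc) => u [v [Uu bu uv vc]] ncd nab.
have au : a != u by apply: contraNneq nab => ->; rewrite joined_sym.
have dv : d != v by apply: contraNneq ncd => ->; rewrite joined_sym.
have [va|va] := eqVneq v a; have [ud|ud] := eqVneq u d.
- subst u v; case: ab => x [y [Ux ax xy yb]].
  have [xd|xd] := eqVneq x d.
    subst x; distinct_red_edges [:: (b, d); (d, a); (a, c); (d, y); (y, b)].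
  have [xc|xc] := eqVneq x c; last first.
    distinct_red_edges [:: (b, d); (d, a); (a, c); (a, x); (x, y)].
  subst x; have yd : y != d by apply: contraNneq ncd => <-.
  distinct_red_edges [:: (b, d); (d, a); (a, c); (c, y); (y, b)].
- subst v; apply: (five_red_edges_overlap U Uu) => //.
  by rewrite eq_sym.
- subst u; apply: (@five_red_edges_overlap h d c b a v);
    rewrite 1?joined_sym // 1?eq_sym //; try exact: red_path3_sym.
  + by move: U; rewrite /= !inE; lia.
  + by move: Uu; rewrite /= !inE; lia.
case: ab cd => x [y [Ux ax xy yb]] [p [q [Up cp pq qd]]].
have [xd|xd] := eqVneq x d; last first.
  distinct_red_edges [:: (b, u); (u, v); (v, c); (a, x); (q, d)].
have [qa|qa] := eqVneq q a; last first.
  distinct_red_edges [:: (b, u); (u, v); (v, c); (a, x); (q, d)].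
subst x q; distinct_red_edges [:: (b, u); (u, v); (v, c); (a, d); (d, y)].
Qed.

(** * The bounds *)

Lemma builder_beats_greedy l k :
  builder_can_win_within (cycle_graph 4) (path_graph l.+1) k ->
  exists h, [/\ size h <= k, ~ has_copy (cycle_graph 4) h red,
    forall u v, joined h blue u v -> red_path3 h u v &
    has_copy (path_graph l.+1) h blue].
Proof.
case=> B _ /(_ greedy) [n lenk win]; have [no4 bl] := greedy_invariant B n.
exists (play B greedy n); split=> //; last by case: win.
by have -> : size (play B greedy n) = n by elim: {+}n => //= m ->.
Qed.

Lemma path_copy_constant h l (f : path_graph l.+1 -> nat) (g : nat -> nat) :
  (forall u v, adj u v -> joined h blue (f u) (f v)) ->
  (forall u v, joined h blue u v -> g u = g v) ->
  forall i, g (f i) = g (f ord0).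
Proof.
move=> fE gj [i]; elim: i => [|i IH] lti.
  by congr (g (f _)); apply: val_inj.
rewrite -(IH (ltnW lti)); symmetry; apply/gj/fE.
by rewrite /= /path_adj /= eqxx.
Qed.

(** This holds for both colours: the vertices of the blue path are connected by
the blue edges and also by the red paths that replace these edges. *)
Lemma rounds_of_blue_path h l c :
  (forall u v, joined h blue u v -> red_path3 h u v) ->
  has_copy (path_graph l.+1) h blue -> l <= rounds c h.
Proof.
move=> bl [f f_inj fE]; have := @rounds_connected h c (codom f).
rewrite size_codom card_ord ltnS; apply; first exact/injectiveP.
move=> g gj u v /codomP[i ->] /codomP[j ->].
suff gb x y : joined h blue x y -> g x = g y.
  by rewrite !(path_copy_constant fE gb).
by case: c gj => gj; [case/bl=> p [q [_ /gj -> /gj -> /gj ->]] | apply: gj].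
Qed.

Lemma lower_bound l k :
  builder_can_win_within (cycle_graph 4) (path_graph l.+1) k -> 2 * l <= k.
Proof.
case/builder_beats_greedy=> h [sz no4 bl cp]; move: sz; rewrite -rounds_red_blue.
have := rounds_of_blue_path red bl cp.
by have := rounds_of_blue_path blue bl cp; lia.
Qed.

Lemma lower_bound_P4 k :
  builder_can_win_within (cycle_graph 4) (path_graph 4) k -> 8 <= k.
Proof.
case/builder_beats_greedy=> h [sz no4 bl cp]; move: sz; rewrite -rounds_red_blue.
have := rounds_of_blue_path blue bl cp; case: cp => f f_inj fE.
pose o i : path_graph 4 := inord i.
have e i : i.+1 < 4 -> red_path3 h (f (o i)) (f (o i.+1)).
  by move=> lti; apply/bl/fE; rewrite /= /path_adj !inordK ?eqxx // ltnW.
suff : 5 <= rounds red h by lia.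
apply: (five_red_edges no4 _ (e 0 isT) (e 1 isT) (e 2 isT)).
by rewrite -[X in uniq X]/(map f [:: o 0; o 1; o 2; o 3]) map_inj_uniq //=
  !inE -!val_eqE /= !inordK.
Qed.

Lemma upper_bound l : 3 <= l ->
  builder_can_win_within (cycle_graph 4) (path_graph l.+1) (4 * l - 4).
Proof.
move=> l3; apply: forces_win; rewrite -[_ - _]addn0.
apply: forces_trans (forces_path l3) _ => h /won_pathW w.
exact: forces0.
Qed.

Lemma online_ramsey_exists G H k : builder_can_win_within G H k ->
  exists r, is_online_ramsey G H r.
Proof.
move=> wk.
pose p j :=
  is_left (excluded_middle_informative (builder_can_win_within G H j)).
have pP j : reflect (builder_can_win_within G H j) (p j).
  by rewrite /p; case: excluded_middle_informative => ?; constructor.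
have ex : exists j, p j by exists k; apply/pP.
by case: (ex_minnP ex) => r /pP wr rmin; exists r; split=> // j /pP /rmin.
Qed.

Theorem theorem1p9 :
  (forall l : nat, 3 <= l ->
     exists2 r : nat,
       is_online_ramsey (cycle_graph 4) (path_graph l.+1) r &
       2 * l <= r <= 4 * l - 4) /\
  is_online_ramsey (cycle_graph 4) (path_graph 4) 8.
Proof.
split=> [l l3|]; last first.
  by split; [apply: (@upper_bound 3) | apply: lower_bound_P4].
have [r [wr rmin]] := online_ramsey_exists (upper_bound l3).
by exists r; rewrite ?(lower_bound wr) ?rmin //; apply: upper_bound.
Qed.
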